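(* For all integers $n,m,x\ge 1$ and $r\ge 0$, $$B_n(x,m,r)=\frac{2\,n!}{\pi\,e^{x/m}}\;\operatorname{Im}\int_{0}^{\pi}\exp\left(\frac{x}{m}\,e^{m e^{i\theta}}\right)\,e^{r e^{i\theta}}\,\sin(n\theta)\,d\theta,$$ where $i$ denotes the imaginary unit.
   Context: The non-degenerate generalized Bell polynomials are $$B_n(x,m,r)=\sum_{k=0}^{n}S(n,k;0,m,r)\,x^k,$$ where the generalized Stirling numbers $S(n,k;0,m,r)$ are defined by $$\sum_{n\ge 0}S(n,k;0,m,r)\frac{z^n}{n!}=\frac{e^{rz}}{k!}\left(\frac{e^{mz}-1}{m}\right)^k .$$ *)

(* Defs.v *)
From Stdlib Require Import Reals Factorial Lra.
From Coquelicot Require Import Coquelicot.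

Open Scope R_scope.

Definition Cexp (z : C) : C :=
  Cmult (RtoC (exp (Re z))) (cos (Im z), sin (Im z)).

(* Formal power series over R are coefficient sequences [nat -> R], as in
   Coquelicot's PSeries; their product is the Cauchy product [PS_mult]. *)

Definition PS_one : nat -> R := fun n => if Nat.eqb n 0 then 1 else 0.

Fixpoint PS_pow (a : nat -> R) (k : nat) : nat -> R :=
  match k with
  | O => PS_one
  | S k' => PS_mult a (PS_pow a k')
  end.

(* e^(c z) *)
Definition PS_exp (c : R) : nat -> R := fun n => c ^ n / INR (fact n).

(* (e^(r z) / k!) * ((e^(m z) - 1) / m)^k *)
Definition genStirling_gf (k : nat) (m r : R) : nat -> R :=
  PS_mult (PS_scal (/ INR (fact k)) (PS_exp r))
          (PS_pow (PS_scal (/ m) (PS_minus (PS_exp m) PS_one)) k).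

(* S(n,k;0,m,r), read off as n! times the coefficient of z^n in its
   exponential generating function. *)
Definition genStirling (n k : nat) (m r : R) : R :=
  INR (fact n) * genStirling_gf k m r n.

Definition genBell (n : nat) (x m r : R) : R :=
  sum_f_R0 (fun k => genStirling n k m r * x ^ k) n.

Lemma CV_radius_entire (a : nat -> R) (f : R -> R) :
  (forall z : R, is_pseries a z (f z)) -> CV_radius a = p_infty.
Proof.
intros H.
assert (K : forall z : R, ~ Rbar_lt (CV_radius a) (Rabs z)).
{ intros z Hz. apply (CV_disk_outside a z Hz).
  apply ex_series_lim_0. apply -> ex_pseries_R. exists (f z). apply H. }
assert (P := CV_radius_ge_0 a).
destruct (CV_radius a) as [c| |]; [|reflexivity|contradiction P].
exfalso. apply (K (Rabs c + 1)). simpl.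
assert (Q := Rle_abs c). assert (Q' := Rle_abs (Rabs c + 1)). lra.
Qed.

Lemma is_pseries_mult_entire (a b : nat -> R) (f g : R -> R) :
  (forall z : R, is_pseries a z (f z)) -> (forall z : R, is_pseries b z (g z)) ->
  forall z : R, is_pseries (PS_mult a b) z (f z * g z).
Proof.
intros Ha Hb z. apply is_pseries_mult; auto;
  [rewrite (CV_radius_entire a f Ha) | rewrite (CV_radius_entire b g Hb)];
  exact I.
Qed.

Lemma is_pseries_one (z : R) : is_pseries PS_one z 1.
Proof.
apply is_pseries_R.
apply (is_series_decr_1 (K := R_AbsRing)).
replace (plus 1 _) with (0 : R).
2:{ unfold plus, opp; simpl. unfold PS_one; simpl. ring. }
apply (filterlim_ext (fun _ => 0)); [|apply filterlim_const].
intros n. rewrite (sum_n_ext _ (fun _ => 0)).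
- rewrite sum_n_const. ring.
- intros p. unfold PS_one; simpl. ring.
Qed.

Lemma is_pseries_exp_scal (c z : R) : is_pseries (PS_exp c) z (exp (c * z)).
Proof.
apply is_pseries_R. assert (H := is_exp_Reals (c * z)).
apply is_pseries_R in H. revert H. apply is_series_ext.
intros n. unfold PS_exp, Rdiv. rewrite Rpow_mult_distr.
change (@eq R (/ INR (fact n) * (c ^ n * z ^ n)) (c ^ n * / INR (fact n) * z ^ n)).
ring.
Qed.

(* The defining identity of the numbers S(n,k;0,m,r), as a convergent power
   series. *)
Lemma genStirling_egf (k : nat) (m r z : R) :
  is_pseries (fun n => genStirling n k m r / INR (fact n)) z
    (exp (r * z) / INR (fact k) * ((exp (m * z) - 1) / m) ^ k).
Proof.
apply (is_pseries_ext (genStirling_gf k m r)).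
{ intros n. unfold genStirling. apply (Rmult_eq_reg_l (INR (fact n))).
  - field. apply INR_fact_neq_0.
  - apply INR_fact_neq_0. }
revert z.
apply is_pseries_mult_entire with
  (f := fun z => exp (r * z) / INR (fact k))
  (g := fun z => ((exp (m * z) - 1) / m) ^ k).
- intros z. unfold Rdiv. rewrite Rmult_comm.
  apply (is_pseries_scal (K := R_AbsRing) (V := R_NormedModule));
    [apply Rmult_comm | apply is_pseries_exp_scal].
- assert (H : forall z : R, is_pseries
    (PS_scal (/ m) (PS_minus (PS_exp m) PS_one)) z ((exp (m * z) - 1) / m)).
  { intros z. unfold Rdiv. rewrite Rmult_comm.
    apply (is_pseries_scal (K := R_AbsRing) (V := R_NormedModule));
      [apply Rmult_comm |].
    apply (is_pseries_minus (K := R_AbsRing) (V := R_NormedModule));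
      [apply is_pseries_exp_scal | apply is_pseries_one]. }
  induction k as [|k IH]; simpl.
  + apply is_pseries_one.
  + apply is_pseries_mult_entire with (f := fun z => (exp (m * z) - 1) / m)
      (g := fun z => ((exp (m * z) - 1) / m) ^ k); assumption.
Qed.

(* Main.v *)
Require Import Defs.
From Stdlib Require Import Reals Factorial Lra Lia.
From Coquelicot Require Import Coquelicot.

Open Scope R_scope.

(** Write [u = e^(i t)] and [y = x / m]. Expanding the outer exponential of
    the integrand,
      [exp (y e^(m u)) e^(r u) = sum_j y^j / j! * e^((m j + r) u)],
    so everything reduces to the integrals of [Im e^(c u) * sin (n t)] for real
    [c]. Expanding once more, [Im e^(c u) = sum_k c^k / k! * sin (k t)], and the
    orthogonality of the sines on [[0, PI]] keeps only the term [k = n]: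
    the integral is [PI / 2 * c^n / n!] ([RInt_Im_Cexp_sin]). Both expansions
    are dominated uniformly in [t], so they may be integrated term by term
    ([is_series_RInt]), and the imaginary part of the integral is
      [PI / (2 n!) * sum_j y^j / j! * (m j + r)^n].

    That sum equals [e^y B_n(m y, m, r)], a formula of Dobinski type
    ([is_series_Dobinski]). It holds because the numbers
    [m^k S(n,k;0,m,r)] are the coordinates of the polynomial [(m X + r)^n] in
    the basis of falling factorials ([sum_genStirling_falling]), and
    [sum_j y^j / j! * j (j-1) ... (j-k+1) = y^k e^y]. The coordinates are
    recognised through the recurrence
      [S(n+1,k+1) = (m (k+1) + r) S(n,k+1) + S(n,k)],
    which is the differential equation of the exponential generating function
    read coefficient by coefficient. *)

(** * Termwise integration of dominated series *)

Lemma ex_series_exp_scal (K q : R) :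
  ex_series (fun k => K * (q ^ k / INR (fact k))).
Proof.
apply (ex_series_scal_l (K := R_AbsRing) (V := R_NormedModule) K).
exists (exp q).
assert (H := is_exp_Reals q). apply -> is_pseries_R in H.
revert H. apply is_series_ext. intros k. unfold Rdiv. apply Rmult_comm.
Qed.

(** Weierstrass domination: the remainder of the series is bounded on the whole
    interval by the remainder of [M], hence so is, up to the factor [b - a],
    the difference between the integral of [F] and that of a partial sum. *)
Lemma is_series_RInt (f : nat -> R -> R) (F : R -> R) (a b : R) (M : nat -> R) :
  a <= b ->
  (forall k, ex_RInt (f k) a b) -> ex_RInt F a b ->
  (forall k t, a <= t <= b -> Rabs (f k t) <= M k) -> ex_series M ->
  (forall t, a <= t <= b -> is_series (fun k => f k t) (F t)) ->
  is_series (fun k => RInt (f k) a b) (RInt F a b).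
Proof.
intros Hab Hf HF HM HMs Hs.
assert (HS : forall N, is_RInt (fun t => sum_n (fun k => f k t) N) a b
                               (sum_n (fun k => RInt (f k) a b) N)).
{ induction N as [|N IH].
  - rewrite sum_O. apply is_RInt_ext with (f 0%nat).
    + intros t _. symmetry. apply (sum_O (fun k => f k t)).
    + apply (RInt_correct (V := R_CompleteNormedModule)), Hf.
  - rewrite sum_Sn.
    apply is_RInt_ext with (fun t => plus (sum_n (fun k => f k t) N) (f (S N) t)).
    + intros t _. symmetry. apply (sum_Sn (fun k => f k t)).
    + apply (is_RInt_plus (V := R_NormedModule)); [exact IH|].
      apply (RInt_correct (V := R_CompleteNormedModule)), Hf. }
assert (Htail : forall N t, a <= t <= b ->
  Rabs (F t - sum_n (fun k => f k t) N) <= Series M - sum_n M N).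
{ intros N t Ht.
  apply (is_lim_seq_le_loc
    (fun n => Rabs (sum_n (fun k => f k t) n - sum_n (fun k => f k t) N))
    (fun n => sum_n M n - sum_n M N)
    (Rabs (F t - sum_n (fun k => f k t) N)) (Series M - sum_n M N)).
  - exists N. intros n Hn. induction Hn as [|n Hn IH].
    + replace (sum_n _ N - _) with 0 by ring. rewrite Rabs_R0. lra.
    + rewrite !sum_Sn. unfold plus; simpl.
      replace (_ + _ - _) with
        (sum_n (fun k => f k t) n - sum_n (fun k => f k t) N + f (S n) t) by ring.
      apply Rle_trans with (1 := Rabs_triang _ _).
      assert (H := HM (S n) t Ht). lra.
  - apply (is_lim_seq_abs _ (F t - _)).
    apply is_lim_seq_minus'; [exact (Hs t Ht) | apply is_lim_seq_const].
  - apply is_lim_seq_minus'; [exact (Series_correct M HMs) | apply is_lim_seq_const]. }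
assert (Hb : forall N, Rabs (RInt F a b - sum_n (fun k => RInt (f k) a b) N)
                       <= (b - a) * (Series M - sum_n M N)).
{ intros N.
  assert (HD : is_RInt (fun t => F t - sum_n (fun k => f k t) N) a b
                 (RInt F a b - sum_n (fun k => RInt (f k) a b) N)).
  { apply (is_RInt_minus (V := R_NormedModule)); [|apply HS].
    apply (RInt_correct (V := R_CompleteNormedModule)), HF. }
  rewrite <- (is_RInt_unique _ _ _ _ HD).
  apply abs_RInt_le_const; [exact Hab | eexists; exact HD |].
  intros t Ht. apply Htail, Ht. }
assert (HL : is_lim_seq (fun N => (b - a) * (Series M - sum_n M N)) 0).
{ replace 0 with ((b - a) * (Series M - Series M)) by ring.
  apply (is_lim_seq_scal_l _ (b - a) (Series M - Series M)).
  apply is_lim_seq_minus'; [apply is_lim_seq_const | exact (Series_correct M HMs)]. }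
change (is_lim_seq (sum_n (fun k => RInt (f k) a b)) (RInt F a b)).
apply is_lim_seq_le_le with
  (u := fun N => RInt F a b - (b - a) * (Series M - sum_n M N))
  (w := fun N => RInt F a b + (b - a) * (Series M - sum_n M N)).
- intros N. assert (H := Hb N). apply Rabs_le_between in H. lra.
- replace (Finite (RInt F a b)) with (Finite (RInt F a b - 0)) by (f_equal; ring).
  apply is_lim_seq_minus'; [apply is_lim_seq_const | exact HL].
- replace (Finite (RInt F a b)) with (Finite (RInt F a b + 0)) by (f_equal; ring).
  apply is_lim_seq_plus'; [apply is_lim_seq_const | exact HL].
Qed.

(** * The complex exponential *)

Lemma Rabs_Im_le_Cmod (z : C) : Rabs (Im z) <= Cmod z.
Proof. apply Rle_trans with (2 := Rmax_Cmod z). apply Rmax_r. Qed.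

Lemma CV_radius_exp_bound (c : nat -> R) (K q : R) :
  0 <= q -> (forall k, Rabs (c k) <= K * (q ^ k / INR (fact k))) ->
  CV_radius c = p_infty.
Proof.
intros Hq Hc. apply (CV_radius_entire c (PSeries c)). intros t.
apply PSeries_correct. apply ex_pseries_R.
apply (ex_series_le (K := R_AbsRing) (V := R_CompleteNormedModule) _
  (fun k => K * ((q * Rabs t) ^ k / INR (fact k)))); [|apply ex_series_exp_scal].
intros k. change (Rabs (c k * t ^ k) <= K * ((q * Rabs t) ^ k / INR (fact k))).
rewrite Rabs_mult, <- RPow_abs, Rpow_mult_distr.
replace (K * _) with (K * (q ^ k / INR (fact k)) * Rabs t ^ k)
  by (unfold Rdiv; ring).
apply Rmult_le_compat_r; [apply pow_le, Rabs_pos | apply Hc].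
Qed.

(** Let [A] and [B] be the real power series in [t] with coefficients the real and
    imaginary parts of [v w^k / k!], so that formally [A + i B = v e^(t w)]. With
    [w = a + i b] they solve the linear system [A' = a A - b B],
    [B' = b A + a B], hence [e^(-t w) (A + i B)] has zero derivative and keeps
    its value [v] at [t = 0]; the claim is the case [t = 1]. The factor [v] is
    there so that taking imaginary parts commutes with multiplying the series
    by a complex constant. *)
Lemma is_series_Im_Cexp (v w : C) :
  is_series (fun k => Im (v * w ^ k)%C / INR (fact k)) (Im (v * Cexp w)%C).
Proof.
set (A := fun k => Re (v * w ^ k)%C / INR (fact k)).
set (B := fun k => Im (v * w ^ k)%C / INR (fact k)).
assert (Hbd : forall (z : C) k, Rabs (Re (z * w ^ k)%C / INR (fact k))
   <= Cmod z * (Cmod w ^ k / INR (fact k)) /\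
   Rabs (Im (z * w ^ k)%C / INR (fact k)) <= Cmod z * (Cmod w ^ k / INR (fact k))).
{ intros z k. assert (Hp := INR_fact_lt_0 k).
  assert (E : Cmod z * (Cmod w ^ k / INR (fact k)) =
              Cmod (z * w ^ k)%C * / INR (fact k)).
  { rewrite Cmod_mult, Cmod_pow. unfold Rdiv. ring. }
  rewrite E. unfold Rdiv. rewrite !Rabs_mult, (Rabs_pos_eq (/ _));
    [|apply Rlt_le, Rinv_0_lt_compat, Hp].
  split; (apply Rmult_le_compat_r; [apply Rlt_le, Rinv_0_lt_compat, Hp|]).
  - apply re_le_Cmod. - apply Rabs_Im_le_Cmod. }
assert (RA : CV_radius A = p_infty).
{ apply (CV_radius_exp_bound A (Cmod v) (Cmod w) (Cmod_ge_0 w)). apply Hbd. }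
assert (RB : CV_radius B = p_infty).
{ apply (CV_radius_exp_bound B (Cmod v) (Cmod w) (Cmod_ge_0 w)). apply Hbd. }
set (a := Re w). set (b := Im w).
assert (EA : forall k, PS_derive A k = a * A k - b * B k).
{ intros k. unfold PS_derive, A, B. rewrite Cpow_S.
  rewrite fact_simpl, mult_INR.
  assert (H1 := INR_fact_neq_0 k). assert (H2 := not_0_INR (S k) (Nat.neq_succ_0 k)).
  replace (Re (v * (w * w ^ k))%C) with
    (a * Re (v * w ^ k)%C - b * Im (v * w ^ k)%C)
    by (unfold a, b, Re, Im, Cmult; simpl; ring).
  field; auto. }
assert (EB : forall k, PS_derive B k = b * A k + a * B k).
{ intros k. unfold PS_derive, A, B. rewrite Cpow_S.
  rewrite fact_simpl, mult_INR.
  assert (H1 := INR_fact_neq_0 k). assert (H2 := not_0_INR (S k) (Nat.neq_succ_0 k)).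
  replace (Im (v * (w * w ^ k))%C) with
    (b * Re (v * w ^ k)%C + a * Im (v * w ^ k)%C)
    by (unfold a, b, Re, Im, Cmult; simpl; ring).
  field; auto. }
assert (SA : forall t, is_series (fun k => A k * t ^ k) (PSeries A t)).
{ intros t. apply -> is_pseries_R. apply PSeries_correct, CV_radius_inside.
  rewrite RA. exact I. }
assert (SB : forall t, is_series (fun k => B k * t ^ k) (PSeries B t)).
{ intros t. apply -> is_pseries_R. apply PSeries_correct, CV_radius_inside.
  rewrite RB. exact I. }
assert (DA : forall t, is_derive (PSeries A) t (a * PSeries A t - b * PSeries B t)).
{ intros t. replace (a * _ - _) with (PSeries (PS_derive A) t).
  - apply is_derive_PSeries. rewrite RA. exact I.
  - apply is_pseries_unique. apply <- is_pseries_R.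
    apply (is_series_ext (fun k => a * (A k * t ^ k) - b * (B k * t ^ k))).
    { intros k. rewrite EA.
      change (@eq R (a * (A k * t ^ k) - b * (B k * t ^ k)) ((a * A k - b * B k) * t ^ k)).
      ring. }
    apply (is_series_minus (K := R_AbsRing) (V := R_NormedModule));
      apply (is_series_scal_l (K := R_AbsRing) (V := R_NormedModule)); auto. }
assert (DB : forall t, is_derive (PSeries B) t (b * PSeries A t + a * PSeries B t)).
{ intros t. replace (b * _ + _) with (PSeries (PS_derive B) t).
  - apply is_derive_PSeries. rewrite RB. exact I.
  - apply is_pseries_unique. apply <- is_pseries_R.
    apply (is_series_ext (fun k => b * (A k * t ^ k) + a * (B k * t ^ k))).
    { intros k. rewrite EB.
      change (@eq R (b * (A k * t ^ k) + a * (B k * t ^ k)) ((b * A k + a * B k) * t ^ k)).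
      ring. }
    apply (is_series_plus (K := R_AbsRing) (V := R_NormedModule));
      apply (is_series_scal_l (K := R_AbsRing) (V := R_NormedModule)); auto. }
(* P and Q are the real and imaginary parts of e^(-t w) (A + i B). *)
set (P := fun t => exp (- a * t) * (PSeries A t * cos (b * t) + PSeries B t * sin (b * t))).
set (Q := fun t => exp (- a * t) * (PSeries B t * cos (b * t) - PSeries A t * sin (b * t))).
assert (HP : P 0 = P 1).
{ apply (eq_is_derive (V := R_NormedModule)); [|lra].
  intros t _. unfold P.
  assert (XA := DA t). assert (XB := DB t).
  auto_derive; [repeat split; eexists; eassumption|].
  replace (Derive (fun s : R => PSeries A s) t) with (a * PSeries A t - b * PSeries B t)
    by (symmetry; apply is_derive_unique, XA).
  replace (Derive (fun s : R => PSeries B s) t) with (b * PSeries A t + a * PSeries B t)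
    by (symmetry; apply is_derive_unique, XB).
  unfold zero; simpl. ring. }
assert (HQ : Q 0 = Q 1).
{ apply (eq_is_derive (V := R_NormedModule)); [|lra].
  intros t _. unfold Q.
  assert (XA := DA t). assert (XB := DB t).
  auto_derive; [repeat split; eexists; eassumption|].
  replace (Derive (fun s : R => PSeries A s) t) with (a * PSeries A t - b * PSeries B t)
    by (symmetry; apply is_derive_unique, XA).
  replace (Derive (fun s : R => PSeries B s) t) with (b * PSeries A t + a * PSeries B t)
    by (symmetry; apply is_derive_unique, XB).
  unfold zero; simpl. ring. }
unfold P, Q in HP, HQ.
rewrite !PSeries_0, !Rmult_0_r, !Rmult_1_r, sin_0, cos_0, exp_0 in HP, HQ.
assert (A0 : A 0%nat = Re v).
{ unfold A, Re, Cmult. simpl. field. }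
assert (B0 : B 0%nat = Im v).
{ unfold B, Im, Cmult. simpl. field. }
rewrite A0, B0 in HP, HQ.
assert (F : Im (v * Cexp w)%C = PSeries B 1).
{ transitivity (exp a * (Im v * cos b + Re v * sin b)).
  - unfold Cexp, Cmult; simpl. fold (Re v) (Im v) (Re w) (Im w). fold a b. ring.
  - replace (Im v) with (exp (- a) * (PSeries B 1 * cos b - PSeries A 1 * sin b)) by lra.
    replace (Re v) with (exp (- a) * (PSeries A 1 * cos b + PSeries B 1 * sin b)) by lra.
    assert (E : exp a * exp (- a) = 1).
    { rewrite <- exp_plus. replace (a + - a) with 0 by ring. apply exp_0. }
    (* Solving the rotation by the angle b for B uses sin^2 + cos^2 = 1. *)
    assert (S := sin2_cos2 b). unfold Rsqr in S.
    replace (PSeries B 1) with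
      ((exp a * exp (- a)) * (PSeries B 1 * (sin b * sin b + cos b * cos b))) at 3
      by (rewrite E, S; ring).
    ring. }
rewrite F. generalize (SB 1). apply is_series_ext.
intros k. rewrite pow1. apply Rmult_1_r.
Qed.

Lemma Cexp_plus (z w : C) : Cexp (z + w)%C = (Cexp z * Cexp w)%C.
Proof.
unfold Cexp, Cmult, Re, Im; simpl. rewrite exp_plus, cos_plus, sin_plus.
apply injective_projections; simpl; ring.
Qed.

Lemma Cexp_pow (z : C) (k : nat) : (Cexp z ^ k)%C = Cexp (RtoC (INR k) * z)%C.
Proof.
induction k as [|k IH].
- replace (RtoC (INR 0) * z)%C with (RtoC 0)
    by (apply injective_projections; simpl; ring).
  unfold Cexp; simpl. rewrite exp_0, cos_0, sin_0.
  apply injective_projections; simpl; ring.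
- rewrite Cpow_S, IH, <- Cexp_plus. f_equal. rewrite S_INR, RtoC_plus. ring.
Qed.

(** * Fourier coefficients of an exponential on the unit circle *)

Definition unit_circle (t : R) : C := Cexp (Ci * RtoC t)%C.

Lemma unit_circle_eq (t : R) : unit_circle t = (cos t, sin t).
Proof.
unfold unit_circle, Cexp; simpl.
replace (0 * t - 1 * 0) with 0 by ring. replace (0 * 0 + 1 * t) with t by ring.
rewrite exp_0. apply injective_projections; simpl; ring.
Qed.

Lemma unit_circle_pow (t : R) (k : nat) :
  (unit_circle t ^ k)%C = unit_circle (INR k * t).
Proof.
unfold unit_circle. rewrite Cexp_pow. f_equal. rewrite RtoC_mult. ring.
Qed.

Lemma Im_Cexp_unit_circle (c t : R) :
  Im (Cexp (RtoC c * unit_circle t)%C) = exp (c * cos t) * sin (c * sin t).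
Proof.
rewrite unit_circle_eq. unfold Cexp; simpl.
replace (c * cos t - 0 * sin t) with (c * cos t) by ring.
replace (c * sin t + 0 * cos t) with (c * sin t) by ring. ring.
Qed.

Lemma RInt_cos_mul (p : Z) :
  is_RInt (fun t => cos (IZR p * t)) 0 PI (if Z.eqb p 0 then PI else 0).
Proof.
destruct (Z.eqb_spec p 0) as [->|Hp].
- apply (is_RInt_ext (fun _ => 1)).
  { intros t _. rewrite Rmult_0_l. symmetry. apply cos_0. }
  replace PI with (scal (PI - 0) 1) at 2 by (unfold scal; simpl; unfold mult; simpl; ring).
  apply (is_RInt_const (V := R_NormedModule)).
- assert (Hp' : IZR p <> 0) by (apply not_0_IZR, Hp).
  replace 0 with (minus (sin (IZR p * PI) / IZR p) (sin (IZR p * 0) / IZR p)) at 2.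
  2:{ rewrite (sin_eq_0_1 (IZR p * PI)) by (exists p; reflexivity).
      rewrite Rmult_0_r, sin_0. unfold minus, plus, opp; simpl. field. exact Hp'. }
  apply (is_RInt_derive (V := R_CompleteNormedModule) (fun t => sin (IZR p * t) / IZR p)).
  + intros t _. auto_derive; [exact I|]. field. exact Hp'.
  + intros t _. apply (ex_derive_continuous (V := R_NormedModule)). auto_derive. exact I.
Qed.

Lemma RInt_sin_mul_sin (k n : nat) :
  (1 <= n)%nat ->
  is_RInt (fun t => sin (INR k * t) * sin (INR n * t)) 0 PI
          (if Nat.eqb k n then PI / 2 else 0).
Proof.
intros Hn.
assert (H1 := RInt_cos_mul (Z.of_nat k - Z.of_nat n)).
assert (H2 := RInt_cos_mul (Z.of_nat k + Z.of_nat n)).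
assert (H := is_RInt_scal _ _ _ (/ 2) _ (is_RInt_minus _ _ _ _ _ _ H1 H2)).
assert (E : / 2 * ((if Z.eqb (Z.of_nat k - Z.of_nat n) 0 then PI else 0)
                   - (if Z.eqb (Z.of_nat k + Z.of_nat n) 0 then PI else 0))
            = if Nat.eqb k n then PI / 2 else 0).
{ destruct (Z.eqb_spec (Z.of_nat k + Z.of_nat n) 0) as [E|_]; [lia|].
  destruct (Z.eqb_spec (Z.of_nat k - Z.of_nat n) 0) as [E|E];
    destruct (Nat.eqb_spec k n) as [E'|E']; try lia; field. }
refine (eq_ind _ (is_RInt (V := R_NormedModule) _ 0 PI) _ _ E).
revert H. apply (is_RInt_ext (V := R_NormedModule)). intros t _.
rewrite minus_IZR, plus_IZR, <- !INR_IZR_INZ, Rmult_minus_distr_r, Rmult_plus_distr_r.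
rewrite cos_plus, cos_minus.
unfold scal, minus, plus, opp; simpl; unfold mult; simpl. field.
Qed.

Lemma is_series_single (a : nat -> R) (n : nat) :
  (forall k, k <> n -> a k = 0) -> is_series a (a n).
Proof.
intros Ha.
assert (Hlim : is_lim_seq (sum_n a) (a n)).
{ apply is_lim_seq_ext_loc with (fun _ => a n); [|apply is_lim_seq_const].
  exists n. intros N HN. symmetry. rewrite sum_n_Reals.
  assert (H0 : forall p, (p < n)%nat -> sum_f_R0 a p = 0).
  { induction p as [|p IH]; intros Hp; simpl.
    - apply Ha; lia. - rewrite IH, Ha by lia. ring. }
  induction HN as [|N HN IH].
  - destruct n as [|n']; simpl; [reflexivity|]. rewrite H0 by lia. ring.
  - simpl. rewrite IH, (Ha (S N)) by lia. ring. }
exact Hlim.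
Qed.

(** The sine series of [Im e^(c u)] on the unit circle is the imaginary part of
    the exponential series; integrating against [sin (n t)] picks its [n]-th
    coefficient by orthogonality. *)
Lemma RInt_Im_Cexp_sin (c : R) (n : nat) :
  (1 <= n)%nat ->
  RInt (fun t => Im (Cexp (RtoC c * unit_circle t)%C) * sin (INR n * t)) 0 PI
    = PI / 2 * (c ^ n / INR (fact n)).
Proof.
intros Hn.
set (f := fun (k : nat) t => c ^ k / INR (fact k) * (sin (INR k * t) * sin (INR n * t))).
assert (Hf : forall k, is_RInt (f k) 0 PI
          (c ^ k / INR (fact k) * (if Nat.eqb k n then PI / 2 else 0))).
{ intros k. apply (is_RInt_scal (V := R_NormedModule)), RInt_sin_mul_sin, Hn. }
assert (HS : is_series (fun k => RInt (f k) 0 PI)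
  (RInt (fun t => Im (Cexp (RtoC c * unit_circle t)%C) * sin (INR n * t)) 0 PI)).
{ apply is_series_RInt with (fun k => 1 * (Rabs c ^ k / INR (fact k))).
  - apply Rlt_le, PI_RGT_0.
  - intros k. eexists. apply Hf.
  - apply (ex_RInt_continuous (V := R_CompleteNormedModule)). intros t _.
    apply continuous_ext with
      (fun t => exp (c * cos t) * sin (c * sin t) * sin (INR n * t)).
    { intros s. rewrite Im_Cexp_unit_circle. reflexivity. }
    apply (ex_derive_continuous (V := R_NormedModule)). auto_derive. exact I.
  - intros k t _. unfold f. rewrite Rabs_mult, Rmult_comm.
    apply Rmult_le_compat; try apply Rabs_pos.
    + rewrite Rabs_mult, <- (Rmult_1_r 1).
      apply Rmult_le_compat; try apply Rabs_pos;
        apply Rabs_le, SIN_bound.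
    + rewrite Rabs_div, <- RPow_abs, (Rabs_pos_eq (INR _)).
      * apply Rle_refl.
      * apply pos_INR.
      * apply INR_fact_neq_0.
  - apply ex_series_exp_scal.
  - intros t _.
    assert (H := is_series_Im_Cexp 1 (RtoC c * unit_circle t)%C).
    rewrite Cmult_1_l in H.
    apply (is_series_scal_r (sin (INR n * t))) in H.
    revert H. apply is_series_ext. intros k. unfold f.
    rewrite Cmult_1_l, Cpow_mult_l, unit_circle_pow, unit_circle_eq, <- RtoC_pow.
    change (@eq R (Im (RtoC (c ^ k) * (cos (INR k * t), sin (INR k * t)))%C
       / INR (fact k) * sin (INR n * t))
      (c ^ k / INR (fact k) * (sin (INR k * t) * sin (INR n * t)))).
    simpl. unfold Rdiv. ring. }
apply is_series_unique in HS. rewrite <- HS.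
apply is_series_unique.
apply (is_series_ext (fun k => c ^ k / INR (fact k) * (if Nat.eqb k n then PI / 2 else 0))).
{ intros k. symmetry. apply is_RInt_unique, Hf. }
replace (PI / 2 * (c ^ n / INR (fact n))) with
  (c ^ n / INR (fact n) * (if Nat.eqb n n then PI / 2 else 0))
  by (rewrite Nat.eqb_refl; ring).
apply (is_series_single (fun k => c ^ k / INR (fact k) * (if Nat.eqb k n then PI / 2 else 0))).
intros k Hk. apply Nat.eqb_neq in Hk. rewrite Hk. ring.
Qed.

(** * Recurrence of the generalized Stirling numbers *)

Lemma genStirling_coef_CV_radius (k : nat) (m r : R) :
  CV_radius (fun n => genStirling n k m r / INR (fact n)) = p_infty.
Proof.
apply (CV_radius_entire _ _ (fun z => genStirling_egf k m r z)).
Qed.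

Lemma genStirling_0_l (k : nat) (m r : R) :
  genStirling 0 k m r = if Nat.eqb k 0 then 1 else 0.
Proof.
assert (H := is_pseries_unique _ _ _ (genStirling_egf k m r 0)).
rewrite PSeries_0 in H.
replace (genStirling 0 k m r) with (genStirling 0 k m r / INR (fact 0))
  by (simpl; field).
rewrite H, !Rmult_0_r, exp_0. unfold Rdiv. rewrite Rminus_diag, Rmult_0_l.
destruct k as [|k]; simpl; [field|ring].
Qed.

(** Differentiating an exponential generating function shifts its sequence by
    one, so any power series for the derivative, explicit in terms of the
    generating functions themselves, yields a recurrence. *)
Lemma genStirling_coef_of_derive (k n : nat) (m r : R) (b : nat -> R) :
  CV_radius b = p_infty ->
  (forall z, is_derive (fun z => exp (r * z) / INR (fact k) * ((exp (m * z) - 1) / m) ^ k) z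
     (PSeries b z)) ->
  genStirling (S n) k m r / INR (fact n) = b n.
Proof.
intros Hb Hd.
set (s := fun n => genStirling n k m r / INR (fact n)).
assert (Hs : CV_radius s = p_infty) by apply genStirling_coef_CV_radius.
transitivity (PS_derive s n).
{ unfold PS_derive, s. rewrite fact_simpl, mult_INR. field.
  split; [apply INR_fact_neq_0 | apply not_0_INR; lia]. }
apply PSeries_ext_recip.
- rewrite CV_radius_derive, Hs. exact I.
- rewrite Hb. exact I.
- apply filter_forall. intros z.
  assert (H : is_derive (PSeries s) z (PSeries (PS_derive s) z)).
  { apply is_derive_PSeries. rewrite Hs. exact I. }
  rewrite <- (is_derive_unique _ _ _ H), <- (is_derive_unique _ _ _ (Hd z)).
  apply Derive_ext. intros t. apply is_pseries_unique, genStirling_egf.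
Qed.

Lemma genStirling_S_0 (n : nat) (m r : R) :
  genStirling (S n) 0 m r = r * genStirling n 0 m r.
Proof.
apply (Rmult_eq_reg_r (/ INR (fact n))); [|apply Rinv_neq_0_compat, INR_fact_neq_0].
change (genStirling (S n) 0 m r / INR (fact n) = r * genStirling n 0 m r / INR (fact n)).
assert (H : forall z, is_pseries (fun n => r * genStirling n 0 m r / INR (fact n)) z
  (r * exp (r * z))).
{ intros z.
  assert (H := is_pseries_scal (K := R_AbsRing) (V := R_NormedModule) r _ _ _
    (Rmult_comm _ _) (genStirling_egf 0 m r z)).
  replace (r * exp (r * z)) with
   (scal r (exp (r * z) / INR (fact 0) * ((exp (m * z) - 1) / m) ^ 0)).
  - revert H. apply is_pseries_ext. intros p. unfold PS_scal, scal; simpl; unfold mult; simpl.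
    unfold Rdiv. ring.
  - unfold scal; simpl; unfold mult; simpl. field. }
apply (genStirling_coef_of_derive 0 n m r (fun n => r * genStirling n 0 m r / INR (fact n))).
- apply (CV_radius_entire _ _ H).
- intros z. rewrite (is_pseries_unique _ _ _ (H z)).
  apply (is_derive_ext (fun z => exp (r * z))).
  + intros t. simpl. field.
  + auto_derive; [exact I|]. ring.
Qed.

(** With [u = (e^(m z) - 1) / m] one has [u' = m u + 1], so that
    [G_k = e^(r z) u^k / k!] satisfies [G_(k+1)' = (m (k+1) + r) G_(k+1) + G_k]. *)
Lemma genStirling_S_S (n k : nat) (m r : R) :
  m <> 0 ->
  genStirling (S n) (S k) m r =
  (m * INR (S k) + r) * genStirling n (S k) m r + genStirling n k m r.
Proof.
intros Hm.
apply (Rmult_eq_reg_r (/ INR (fact n))); [|apply Rinv_neq_0_compat, INR_fact_neq_0].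
set (b := fun n => ((m * INR (S k) + r) * genStirling n (S k) m r + genStirling n k m r)
            / INR (fact n)).
change (genStirling (S n) (S k) m r / INR (fact n) = b n).
set (G := fun k z => exp (r * z) / INR (fact k) * ((exp (m * z) - 1) / m) ^ k).
assert (H : forall z, is_pseries b z ((m * INR (S k) + r) * G (S k) z + G k z)).
{ intros z.
  assert (H1 := is_pseries_scal (K := R_AbsRing) (V := R_NormedModule)
    (m * INR (S k) + r) _ _ _ (Rmult_comm _ _) (genStirling_egf (S k) m r z)).
  assert (H2 := is_pseries_plus (K := R_AbsRing) (V := R_NormedModule) _ _ _ _ _
    H1 (genStirling_egf k m r z)).
  revert H2. apply is_pseries_ext. intros p.
  unfold PS_plus, PS_scal, scal, plus, b; simpl; unfold mult; simpl.
  unfold Rdiv. ring. }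
apply genStirling_coef_of_derive.
- apply (CV_radius_entire _ _ H).
- intros z. rewrite (is_pseries_unique _ _ _ (H z)).
  set (u := fun z => (exp (m * z) - 1) / m).
  assert (Du : is_derive u z (m * u z + 1)).
  { unfold u. auto_derive; [exact I|]. field. exact Hm. }
  assert (D1 : forall q, is_derive (fun z => exp (r * z) / q) z (r * (exp (r * z) / q))).
  { intros q. auto_derive; [exact I|]. unfold Rdiv; ring. }
  assert (D := is_derive_mult _ _ _ _ _ (D1 (INR (fact (S k)))) (is_derive_pow u (S k) z _ Du) Rmult_comm).
  replace ((m * INR (S k) + r) * G (S k) z + G k z) with
    (plus (mult (r * (exp (r * z) / INR (fact (S k)))) (u z ^ S k))
          (mult (exp (r * z) / INR (fact (S k)))
                (INR (S k) * (m * u z + 1) * u z ^ pred (S k)))).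
  + exact D.
  + unfold G. fold (u z). rewrite fact_simpl, mult_INR.
    assert (HS := not_0_INR (S k) (Nat.neq_succ_0 k)).
    assert (Hf := INR_fact_neq_0 k).
    change (@eq R
      (r * (exp (r * z) / (INR (S k) * INR (fact k))) * (u z * u z ^ k) +
       exp (r * z) / (INR (S k) * INR (fact k)) *
         (INR (S k) * (m * u z + 1) * u z ^ k))
      ((m * INR (S k) + r) *
         (exp (r * z) / (INR (S k) * INR (fact k)) * (u z * u z ^ k)) +
       exp (r * z) / INR (fact k) * u z ^ k)).
    field. auto.
Qed.

(** * Dobinski's formula *)

Fixpoint falling (x : R) (k : nat) : R :=
  match k with O => 1 | S k' => falling x k' * (x - INR k') end.

Lemma falling_0_S (k : nat) : falling 0 (S k) = 0.
Proof.
induction k as [|k IH]; [simpl; ring|].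
change (falling 0 (S k) * (0 - INR (S k)) = 0). rewrite IH. ring.
Qed.

Lemma falling_S_S (x : R) (k : nat) : falling (x + 1) (S k) = (x + 1) * falling x k.
Proof.
induction k as [|k IH]; [simpl; ring|].
change (falling (x + 1) (S k) * (x + 1 - INR (S k)) = (x + 1) * (falling x k * (x - INR k))).
rewrite IH, S_INR. ring.
Qed.

(** The falling factorial cancels the first [k] factors of [j!], leaving the
    exponential series shifted by [k]; the induction on [k] shifts it by one
    each time. *)
Lemma is_series_falling (k : nat) (y : R) :
  is_series (fun j => y ^ j / INR (fact j) * falling (INR j) k) (y ^ k * exp y).
Proof.
induction k as [|k IH].
- simpl. rewrite Rmult_1_l.
  assert (H := is_exp_Reals y). apply -> is_pseries_R in H.
  revert H. apply is_series_ext. intros j.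
  change (@eq R (/ INR (fact j) * y ^ j) (y ^ j / INR (fact j) * 1)).
  unfold Rdiv. ring.
- apply (is_series_decr_1 (K := R_AbsRing) (V := R_NormedModule)).
  rewrite falling_0_S.
  replace (plus _ _) with (scal y (y ^ k * exp y)).
  2:{ unfold scal, plus, opp; simpl; unfold mult; simpl. ring. }
  apply (is_series_scal_l (K := R_AbsRing) (V := R_NormedModule) y) in IH.
  revert IH. apply is_series_ext. intros j.
  rewrite (S_INR j), falling_S_S, fact_simpl, mult_INR, S_INR.
  change (@eq R (y * (y ^ j / INR (fact j) * falling (INR j) k))
    (y * y ^ j / ((INR j + 1) * INR (fact j)) * ((INR j + 1) * falling (INR j) k))).
  field. split; [apply INR_fact_neq_0 | rewrite <- S_INR; apply not_0_INR; lia].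
Qed.

Lemma genStirling_above (n k : nat) (m r : R) :
  m <> 0 -> (n < k)%nat -> genStirling n k m r = 0.
Proof.
intros Hm. revert k. induction n as [|n IH]; intros k Hk.
- rewrite genStirling_0_l. destruct k; [lia|reflexivity].
- destruct k as [|k]; [lia|]. rewrite genStirling_S_S, !IH by (assumption || lia). ring.
Qed.

(** Multiplying by [m j + r] sends the [k]-th falling factorial [F_k] to
    [m F_(k+1) + (m k + r) F_k], which is the recurrence of the generalized
    Stirling numbers seen from the other side. *)
Lemma sum_genStirling_falling (n : nat) (m r j : R) :
  m <> 0 ->
  sum_f_R0 (fun k => genStirling n k m r * (m ^ k * falling j k)) n = (m * j + r) ^ n.
Proof.
intros Hm. induction n as [|n IH].
- simpl. rewrite genStirling_0_l. simpl. ring.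
- rewrite decomp_sum by lia. simpl pred. rewrite genStirling_S_0.
  set (g := fun k => (m * INR k + r) * genStirling n k m r * (m ^ k * falling j k)).
  set (h := fun k => genStirling n k m r * (m ^ S k * falling j (S k))).
  rewrite (sum_eq _ (fun k => g (S k) + h k)).
  2:{ intros i _. rewrite genStirling_S_S by exact Hm. unfold g, h. ring. }
  rewrite sum_plus.
  assert (Eg : r * genStirling n 0 m r * (m ^ 0 * falling j 0) + sum_f_R0 (fun k => g (S k)) n
               = sum_f_R0 g n).
  { transitivity (sum_f_R0 g (S n)).
    - rewrite (decomp_sum g (S n)) by lia. unfold g. simpl. ring.
    - simpl. unfold g at 2. rewrite (genStirling_above n (S n)) by (assumption || lia). ring. }
  (* The terms g gather the contribution of (m k + r) F_k, the terms h that of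
     m F_(k+1). *)
  rewrite <- Rplus_assoc, Eg, <- sum_plus.
  change ((m * j + r) ^ S n) with ((m * j + r) * (m * j + r) ^ n).
  rewrite <- IH, scal_sum. apply sum_eq. intros k _. unfold g, h. simpl. ring.
Qed.

(** Expand [(m j + r)^n] in falling factorials of [j]: the [k]-th one
    contributes the series of [y^k e^y], with coefficient [m^k S(n,k;0,m,r)]. *)
Lemma is_series_Dobinski (n : nat) (y m r : R) :
  m <> 0 ->
  is_series (fun j => y ^ j / INR (fact j) * (m * INR j + r) ^ n)
            (exp y * genBell n (m * y) m r).
Proof.
intros Hm.
(* The number N of terms is decoupled from n to allow an induction on it. *)
assert (H : forall N, is_series (fun j => y ^ j / INR (fact j) *
   sum_f_R0 (fun k => genStirling n k m r * (m ^ k * falling (INR j) k)) N)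
   (exp y * sum_f_R0 (fun k => genStirling n k m r * (m * y) ^ k) N)).
{ assert (Hk : forall k, is_series (fun j => y ^ j / INR (fact j) *
     (genStirling n k m r * (m ^ k * falling (INR j) k)))
     (exp y * (genStirling n k m r * (m * y) ^ k))).
  { intros k.
    replace (exp y * _) with (scal (genStirling n k m r * m ^ k) (y ^ k * exp y)).
    2:{ rewrite Rpow_mult_distr. unfold scal; simpl; unfold mult; simpl. ring. }
    assert (H := is_series_scal_l (K := R_AbsRing) (V := R_NormedModule)
      (genStirling n k m r * m ^ k) _ _ (is_series_falling k y)).
    revert H. apply is_series_ext. intros j. unfold scal; simpl; unfold mult; simpl. ring. }
  induction N as [|N IH]; [exact (Hk 0%nat)|].
  simpl sum_f_R0. rewrite Rmult_plus_distr_l.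
  assert (H := is_series_plus (K := R_AbsRing) (V := R_NormedModule) _ _ _ _ IH (Hk (S N))).
  revert H. apply is_series_ext. intros j. unfold plus; simpl. ring. }
generalize (H n). apply is_series_ext. intros j.
rewrite sum_genStirling_falling by exact Hm. reflexivity.
Qed.

(** * The integral representation *)

Lemma Rabs_Im_Cexp_unit_circle_le (c t : R) :
  Rabs (Im (Cexp (RtoC c * unit_circle t)%C)) <= exp (Rabs c).
Proof.
rewrite Im_Cexp_unit_circle, Rabs_mult, <- (Rmult_1_r (exp (Rabs c))).
apply Rmult_le_compat; try apply Rabs_pos; [|apply Rabs_le, SIN_bound].
rewrite Rabs_pos_eq by apply Rlt_le, exp_pos.
assert (H : c * cos t <= Rabs c).
{ apply Rle_trans with (1 := Rle_abs _). rewrite Rabs_mult, <- (Rmult_1_r (Rabs c)).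
  rewrite Rmult_assoc, Rmult_1_l.
  apply Rmult_le_compat_l; [apply Rabs_pos | apply Rabs_le, COS_bound]. }
destruct H as [H|H]; [apply Rlt_le, exp_increasing, H | rewrite H; apply Rle_refl].
Qed.

Definition bell_integrand (y m r : R) (n : nat) (t : R) : C :=
  (Cexp (RtoC y * Cexp (RtoC m * unit_circle t))
   * Cexp (RtoC r * unit_circle t) * RtoC (sin (INR n * t)))%C.

(** Differentiability is handled componentwise and propagated through products
    and exponentials, as the real and imaginary parts of the nested
    exponentials are too large to be written out. *)
Definition derivable_parts (f : R -> C) (t : R) : Prop :=
  ex_derive (fun s => Re (f s)) t /\ ex_derive (fun s => Im (f s)) t.

Lemma ex_RInt_derivable_parts (f : R -> C) (a b : R) :
  (forall t, derivable_parts f t) ->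
  ex_RInt (V := C_R_CompleteNormedModule) f a b.
Proof.
intros Hf.
apply (ex_RInt_fct_extend_pair (U := R_NormedModule) (V := R_NormedModule));
  apply (ex_RInt_continuous (V := R_CompleteNormedModule)); intros t _;
  apply (ex_derive_continuous (V := R_NormedModule)).
- exact (proj1 (Hf t)).
- exact (proj2 (Hf t)).
Qed.

Lemma derivable_parts_RtoC (g : R -> R) (t : R) :
  ex_derive g t -> derivable_parts (fun s => RtoC (g s)) t.
Proof.
intros Hg. split.
- apply (ex_derive_ext g); [reflexivity | exact Hg].
- apply (ex_derive_ext (fun _ => 0)); [reflexivity | auto_derive; exact I].
Qed.

Lemma derivable_parts_mult (f g : R -> C) (t : R) :
  derivable_parts f t -> derivable_parts g t ->
  derivable_parts (fun s => f s * g s)%C t.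
Proof.
intros [Hf1 Hf2] [Hg1 Hg2]. split.
- apply (ex_derive_ext (fun s => Re (f s) * Re (g s) - Im (f s) * Im (g s))).
  { intros s. reflexivity. }
  apply (ex_derive_minus (V := R_NormedModule)); apply ex_derive_mult; assumption.
- apply (ex_derive_ext (fun s => Re (f s) * Im (g s) + Im (f s) * Re (g s))).
  { intros s. reflexivity. }
  apply (ex_derive_plus (V := R_NormedModule)); apply ex_derive_mult; assumption.
Qed.

Lemma derivable_parts_Cexp (f : R -> C) (t : R) :
  derivable_parts f t -> derivable_parts (fun s => Cexp (f s)) t.
Proof.
intros [Hf1 Hf2].
assert (He : ex_derive (fun s => exp (Re (f s))) t).
{ apply (ex_derive_comp exp (fun s => Re (f s))); [auto_derive; exact I | exact Hf1]. }
split.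
- apply (ex_derive_ext (fun s => exp (Re (f s)) * cos (Im (f s)))).
  { intros s. unfold Cexp, Re, Im; simpl. ring. }
  apply ex_derive_mult; [exact He|].
  apply (ex_derive_comp cos (fun s => Im (f s))); [auto_derive; exact I | exact Hf2].
- apply (ex_derive_ext (fun s => exp (Re (f s)) * sin (Im (f s)))).
  { intros s. unfold Cexp, Re, Im; simpl. ring. }
  apply ex_derive_mult; [exact He|].
  apply (ex_derive_comp sin (fun s => Im (f s))); [auto_derive; exact I | exact Hf2].
Qed.

Lemma derivable_parts_unit_circle (t : R) : derivable_parts unit_circle t.
Proof.
split.
- apply (ex_derive_ext cos); [intros s; rewrite unit_circle_eq; reflexivity|].
  auto_derive. exact I.
- apply (ex_derive_ext sin); [intros s; rewrite unit_circle_eq; reflexivity|].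
  auto_derive. exact I.
Qed.

Lemma derivable_parts_bell_integrand (y m r : R) (n : nat) (t : R) :
  derivable_parts (bell_integrand y m r n) t.
Proof.
assert (Hc : forall c : R, derivable_parts (fun _ => RtoC c) t).
{ intros c. apply (derivable_parts_RtoC (fun _ => c)). auto_derive. exact I. }
assert (He : forall c : R, derivable_parts (fun s => Cexp (RtoC c * unit_circle s)%C) t).
{ intros c. apply derivable_parts_Cexp, derivable_parts_mult; [apply Hc|].
  apply derivable_parts_unit_circle. }
apply derivable_parts_mult; [apply derivable_parts_mult|].
- apply derivable_parts_Cexp, derivable_parts_mult; [apply Hc | apply He].
- apply He.
- apply (derivable_parts_RtoC (fun s => sin (INR n * s))). auto_derive. exact I.
Qed.

Lemma Im_RInt (f : R -> C) (a b : R) :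
  ex_RInt (V := C_R_CompleteNormedModule) f a b ->
  Im (RInt (V := C_R_CompleteNormedModule) f a b) = RInt (fun t => Im (f t)) a b.
Proof.
intros Hf. symmetry. apply (is_RInt_unique (V := R_CompleteNormedModule)).
exact (is_RInt_fct_extend_snd (U := R_NormedModule) (V := R_NormedModule) f a b _
  (RInt_correct (V := C_R_CompleteNormedModule) f a b Hf)).
Qed.

Lemma ex_RInt_bell_integrand (y m r : R) (n : nat) :
  ex_RInt (V := C_R_CompleteNormedModule) (bell_integrand y m r n) 0 PI.
Proof.
apply ex_RInt_derivable_parts. intros t. apply derivable_parts_bell_integrand.
Qed.

(** Expanding [exp (y e^(m u))] gives the terms [y^j / j! * Im e^((m j + r) u)],
    dominated by [e^|r| (|y| e^|m|)^j / j!]; integrating them produces exactly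
    the terms of Dobinski's formula. *)
Lemma RInt_Im_bell_integrand (y m r : R) (n : nat) :
  (1 <= n)%nat -> m <> 0 ->
  RInt (fun t => Im (bell_integrand y m r n t)) 0 PI
    = PI / 2 * / INR (fact n) * (exp y * genBell n (m * y) m r).
Proof.
intros Hn Hm.
set (f := fun (j : nat) t => y ^ j / INR (fact j) *
   (Im (Cexp (RtoC (m * INR j + r) * unit_circle t)%C) * sin (INR n * t))).
assert (Hex : forall j, ex_RInt (fun t =>
   Im (Cexp (RtoC (m * INR j + r) * unit_circle t)%C) * sin (INR n * t)) 0 PI).
{ intros j. apply (ex_RInt_continuous (V := R_CompleteNormedModule)). intros t _.
  apply continuous_ext with (fun t => exp ((m * INR j + r) * cos t)
    * sin ((m * INR j + r) * sin t) * sin (INR n * t)).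
  { intros s. rewrite Im_Cexp_unit_circle. reflexivity. }
  apply (ex_derive_continuous (V := R_NormedModule)). auto_derive. exact I. }
assert (HS : is_series (fun j => RInt (f j) 0 PI)
  (RInt (fun t => Im (bell_integrand y m r n t)) 0 PI)).
{ apply is_series_RInt with
    (fun j => exp (Rabs r) * ((Rabs y * exp (Rabs m)) ^ j / INR (fact j))).
  - apply Rlt_le, PI_RGT_0.
  - intros j. apply (ex_RInt_scal (V := R_NormedModule)), Hex.
  - apply (ex_RInt_fct_extend_snd (U := R_NormedModule) (V := R_NormedModule)),
      ex_RInt_bell_integrand.
  - intros j t _. unfold f.
    assert (Hfact : 0 <= / INR (fact j)).
    { apply Rlt_le, Rinv_0_lt_compat, INR_fact_lt_0. }
    assert (Hexp : exp (Rabs (m * INR j + r)) <= exp (Rabs m) ^ j * exp (Rabs r)).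
    { assert (Hpow : exp (Rabs m) ^ j = exp (Rabs m * INR j)).
      { rewrite <- Rpower_pow by apply exp_pos. unfold Rpower.
        rewrite ln_exp. f_equal. ring. }
      rewrite Hpow, <- exp_plus.
      assert (H : Rabs (m * INR j + r) <= Rabs m * INR j + Rabs r).
      { apply Rle_trans with (1 := Rabs_triang _ _).
        rewrite Rabs_mult, (Rabs_pos_eq (INR j)) by apply pos_INR. apply Rle_refl. }
      destruct H as [H|H]; [apply Rlt_le, exp_increasing; lra | right; f_equal; lra]. }
    unfold Rdiv. rewrite !Rabs_mult, <- RPow_abs, (Rabs_pos_eq (/ _)) by exact Hfact.
    rewrite Rpow_mult_distr.
    replace (exp (Rabs r) * _) with
      (Rabs y ^ j * / INR (fact j) * ((exp (Rabs m) ^ j * exp (Rabs r)) * 1)) by ring.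
    apply Rmult_le_compat_l.
    { apply Rmult_le_pos; [apply pow_le, Rabs_pos | exact Hfact]. }
    apply Rmult_le_compat; try apply Rabs_pos; [|apply Rabs_le, SIN_bound].
    apply Rle_trans with (2 := Hexp), Rabs_Im_Cexp_unit_circle_le.
  - apply ex_series_exp_scal.
  - intros t _.
    assert (H := is_series_Im_Cexp (Cexp (RtoC r * unit_circle t))
                   (RtoC y * Cexp (RtoC m * unit_circle t))%C).
    apply (is_series_scal_r (sin (INR n * t))) in H.
    replace (Im (bell_integrand y m r n t)) with
      (Im (Cexp (RtoC r * unit_circle t) *
           Cexp (RtoC y * Cexp (RtoC m * unit_circle t)))%C * sin (INR n * t))
      by (unfold bell_integrand, Im, Cmult; simpl; ring).
    revert H. apply is_series_ext. intros j. unfold f.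
    rewrite Cpow_mult_l, Cexp_pow, <- RtoC_pow.
    replace (RtoC (m * INR j + r) * unit_circle t)%C with
      (RtoC r * unit_circle t + RtoC (INR j) * (RtoC m * unit_circle t))%C
      by (rewrite RtoC_plus, RtoC_mult; ring).
    rewrite Cexp_plus.
    set (A := Cexp _). set (B := Cexp _).
    change (@eq R (Im (A * (RtoC (y ^ j) * B))%C / INR (fact j) * sin (INR n * t))
      (y ^ j / INR (fact j) * (Im (A * B)%C * sin (INR n * t)))).
    unfold Im, Cmult; simpl. unfold Rdiv. ring. }
apply is_series_unique in HS. rewrite <- HS. apply is_series_unique.
assert (H := is_series_scal_l (K := R_AbsRing) (V := R_NormedModule)
  (PI / 2 * / INR (fact n)) _ _ (is_series_Dobinski n y m r Hm)).
revert H. apply is_series_ext. intros j. unfold f.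
rewrite (RInt_scal (V := R_CompleteNormedModule)) by apply Hex.
rewrite RInt_Im_Cexp_sin by exact Hn.
match goal with |- ?l = ?r => change (@eq R l r) end.
unfold scal; simpl; unfold mult; simpl. unfold Rdiv. ring.
Qed.

Theorem theorem2p4 :
  forall n m x r : nat,
    (1 <= n)%nat -> (1 <= m)%nat -> (1 <= x)%nat ->
    genBell n (INR x) (INR m) (INR r) =
    2 * INR (fact n) / (PI * exp (INR x / INR m)) *
    Im (RInt (V := C_R_CompleteNormedModule)
          (fun theta : R =>
             (Cexp (RtoC (INR x / INR m) *
                    Cexp (RtoC (INR m) * Cexp (Ci * RtoC theta)))
              * Cexp (RtoC (INR r) * Cexp (Ci * RtoC theta))
              * RtoC (sin (INR n * theta)))%C)
          0 PI).
Proof.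
intros n m x r Hn Hm _.
assert (Hm' : INR m <> 0) by (apply not_0_INR; lia).
set (y := INR x / INR m).
change (genBell n (INR x) (INR m) (INR r) = 2 * INR (fact n) / (PI * exp y) *
  Im (RInt (V := C_R_CompleteNormedModule) (bell_integrand y (INR m) (INR r) n) 0 PI)).
rewrite Im_RInt by apply ex_RInt_bell_integrand.
rewrite RInt_Im_bell_integrand by assumption.
replace (INR m * y) with (INR x) by (unfold y; field; exact Hm').
field. split; [|split].
- apply INR_fact_neq_0.
- apply Rgt_not_eq, exp_pos.
- apply PI_neq0.
Qed.
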